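(* Let $(\mathcal{A},[\cdot,\cdot],N)$ be an $S$-adjoint-admissible Nijenhuis mock-Lie algebra, where $S:\mathcal{A}\to\mathcal{A}$ is linear, and let $r=\sum_ia_i\otimes b_i\in\mathcal{A}\otimes\mathcal{A}$. Define $\Delta:\mathcal{A}\to\mathcal{A}\otimes\mathcal{A}$ by $\Delta(x)=\sum_i[x,a_i]\otimes b_i-a_i\otimes[x,b_i]$. Then $(\mathcal{A},[\cdot,\cdot],\Delta,N,S)$ is a Nijenhuis mock-Lie bialgebra if and only if the following four equations hold for all $x\in\mathcal{A}$: $$(ad(x)\otimes\mathrm{id}-\mathrm{id}\otimes ad(x))(r+\tau(r))=0,$$ $$(ad(x)\otimes\mathrm{id}\otimes\mathrm{id}+\mathrm{id}\otimes ad(x)\otimes\mathrm{id}+\mathrm{id}\otimes\mathrm{id}\otimes ad(x))([r_{12},r_{13}]+[r_{13},r_{23}]-[r_{12},r_{23}])=0,$$ $$(\mathrm{id}\otimes ad(S(x))-\mathrm{id}\otimes S\circ ad(x))(S\otimes\mathrm{id}-\mathrm{id}\otimes N)(r)+(ad(S(x))\otimes\mathrm{id}-S\circ ad(x)\otimes\mathrm{id})(N\otimes\mathrm{id}-\mathrm{id}\otimes S)(r)=0,$$ $$\begin{aligned}&(S\circ ad(x)\otimes\mathrm{id}+ad(N(x))\otimes\mathrm{id}-\mathrm{id}\otimes ad(N(x))+\mathrm{id}\otimes N\circ ad(x))(S\otimes\mathrm{id}-\mathrm{id}\otimes N)(r)\\&+(ad(x)\otimes N^2-ad(x)\circ S^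2\otimes\mathrm{id})(r)=0.\end{aligned}$$
   Context: All vector spaces are over a field $K$ of characteristic zero. $ad(x)(y)=[x,y]$ and $\tau$ is the flip on $\mathcal{A}\otimes\mathcal{A}$. For $r=\sum_ia_i\otimes b_i$: $[r_{12},r_{13}]=\sum_{i,j}[a_i,a_j]\otimes b_i\otimes b_j$, $[r_{13},r_{23}]=\sum_{i,j}a_i\otimes a_j\otimes[b_i,b_j]$, $[r_{12},r_{23}]=\sum_{i,j}a_i\otimes[b_i,a_j]\otimes b_j$. A mock-Lie algebra is a vector space with a commutative bilinear map $[\cdot,\cdot]$ such that $[x,[y,z]]+[y,[z,x]]+[z,[x,y]]=0$. A Nijenhuis mock-Lie algebra $(\mathcal{A},[\cdot,\cdot],N)$ is a mock-Lie algebra with a linear map $N$ such that $[N(x),N(y)]+N^2([x,y])=N([N(x),y])+N([x,N(y)])$. It is $S$-adjoint-admissible if $S([N(x),y])+[x,S^2(y)]=[N(x),S(y)]+S([x,S(y)])$ for all $x,y$. A mock-Lie coalgebra $(\mathcal{A},\Delta)$, $\Delta(x)=x_{(1)}\otimes x_{(2)}$, satisfies $x_{(1)}\otimes x_{(2)}=x_{(2)}\otimes x_{(1)}$ and $x_{(1)}\otimes x_{(2)(1)}\otimes x_{(2)(2)}+x_{(1)(1)}\otimes x_{(1)(2)}\otimes x_{(2)}+x_{(2)(1)}\otimes x_{(1)}\otimes x_{(2)(2)}=0$. A mock-Lie bialgebra is a mock-Lie algebra and mock-Lie coalgebra with $\Delta([x,y])=-[x,y_{(1)}]\otimes y_{(2)}-y_{(1)}\otimes[x,y_{(2)}]-[y,x_{(1)}]\otimes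 x_{(2)}-x_{(1)}\otimes[y,x_{(2)}]$. A Nijenhuis mock-Lie coalgebra $(\mathcal{A},\Delta,S)$ is a mock-Lie coalgebra with a linear map $S$ such that $(S\otimes S)\Delta+\Delta S^2=(S\otimes\mathrm{id})\Delta S+(\mathrm{id}\otimes S)\Delta S$. A Nijenhuis mock-Lie bialgebra $(\mathcal{A},[\cdot,\cdot],\Delta,N,S)$ consists of a mock-Lie bialgebra $(\mathcal{A},[\cdot,\cdot],\Delta)$ such that $(\mathcal{A},[\cdot,\cdot],N)$ is an $S$-adjoint-admissible Nijenhuis mock-Lie algebra, $(\mathcal{A},\Delta,S)$ is a Nijenhuis mock-Lie coalgebra, and $(S\otimes\mathrm{id})\Delta N+(\mathrm{id}\otimes N^2)\Delta=(S\otimes N)\Delta+(\mathrm{id}\otimes N)\Delta N$. *)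

(* Defs.v *)
From HB Require Import structures.
From mathcomp Require Import all_boot all_algebra generic_quotient ring_quotient.
From mathcomp Require Import boolp freeg.

Set Implicit Arguments.
Unset Strict Implicit.
Unset Printing Implicit Defensive.

Import GRing.Theory.
Local Open Scope ring_scope.
Local Open Scope quotient_scope.

(* Tensor product of two (arbitrary-dimensional) K-vector spaces: the free     *)
(* K-module on U * V modulo the subspace generated by the bilinearity          *)
(* relations.                                                                  *)
Section TensorDef.
Variables (K : fieldType) (U V : lmodType K).

Inductive tensor_null : {freeg (U * V) / K} -> Prop :=
| tensor_null0 : tensor_null 0
| tensor_nullD t s : tensor_null t -> tensor_null s -> tensor_null (t + s)
| tensor_nullZ c t : tensor_null t -> tensor_null (c *: t)
| tensor_null_addl u u' v :
    tensor_null (<< (u + u', v) >> - << (u, v) >> - << (u', v) >>)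
| tensor_null_addr u v v' :
    tensor_null (<< (u, v + v') >> - << (u, v) >> - << (u, v') >>)
| tensor_null_scalel c u v :
    tensor_null (<< (c *: u, v) >> - c *: << (u, v) >>)
| tensor_null_scaler c u v :
    tensor_null (<< (u, c *: v) >> - c *: << (u, v) >>).

Definition tensor_nullb : {pred {freeg (U * V) / K}} :=
  fun t => `[< tensor_null t >].

Lemma tensor_nullbP t : reflect (tensor_null t) (t \in tensor_nullb).
Proof. exact: asboolP. Qed.

Fact tensor_nullb_zmod_closed : zmod_closed tensor_nullb.
Proof.
split=> [|t s /tensor_nullbP nt /tensor_nullbP ns]; apply/tensor_nullbP.
  exact: tensor_null0.
by rewrite -scaleN1r; apply: tensor_nullD => //; apply: tensor_nullZ.
Qed.
HB.instance Definition _ :=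
  GRing.isZmodClosed.Build _ tensor_nullb tensor_nullb_zmod_closed.

Definition tensor : Type := (Quotient.quot tensor_nullb).
HB.instance Definition _ := GRing.Zmodule.on tensor.

Definition tensor_pi : {freeg (U * V) / K} -> tensor := \pi_(Quotient.quot tensor_nullb).
HB.instance Definition _ := GRing.isZmodMorphism.Build _ _ tensor_pi
  (@pi_is_zmod_morphism _ _ _ (Quotient.quot tensor_nullb)).

Fact tensor_piP t s : tensor_pi t = tensor_pi s <-> tensor_null (t - s).
Proof.
split=> [/eqP|h]; last apply/eqP.
  by rewrite /tensor_pi -Quotient.idealrBE => /tensor_nullbP.
by rewrite /tensor_pi -Quotient.idealrBE; apply/tensor_nullbP.
Qed.

Fact tensor_pi_surj (t : tensor) : tensor_pi (repr t) = t.
Proof. exact: (@reprK _ (Quotient.quot tensor_nullb)). Qed.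

Definition tensor_scale (c : K) (t : tensor) : tensor := tensor_pi (c *: repr t).

Fact tensor_scale_pi c t : tensor_scale c (tensor_pi t) = tensor_pi (c *: t).
Proof.
apply/tensor_piP; rewrite -scalerBr; apply: tensor_nullZ; apply/tensor_piP.
exact: tensor_pi_surj.
Qed.

Fact tensor_scaleA a b t :
  tensor_scale a (tensor_scale b t) = tensor_scale (a * b) t.
Proof. by rewrite -[t]tensor_pi_surj !tensor_scale_pi scalerA. Qed.
Fact tensor_scale1 : left_id 1 tensor_scale.
Proof. by move=> t; rewrite -[t]tensor_pi_surj tensor_scale_pi scale1r. Qed.
Fact tensor_scaleDr : right_distributive tensor_scale +%R.
Proof.
move=> c t s; rewrite -[t]tensor_pi_surj -[s]tensor_pi_surj.
by rewrite -raddfD !tensor_scale_pi scalerDr raddfD.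
Qed.
Fact tensor_scaleDl t : {morph tensor_scale^~ t : a b / a + b}.
Proof.
move=> a b /=; rewrite -[t]tensor_pi_surj !tensor_scale_pi.
by rewrite scalerDl raddfD.
Qed.
HB.instance Definition _ := GRing.Zmodule_isLmodule.Build K tensor
  tensor_scaleA tensor_scale1 tensor_scaleDr tensor_scaleDl.

Definition tens (u : U) (v : V) : tensor := tensor_pi << (u, v) >>.

Fact tens_is_bilinear :
  bilinear_for (GRing.Scale.Law.clone _ _ *:%R _)
    (GRing.Scale.Law.clone _ _ *:%R _) tens.
Proof.
have Z (q p y z : {freeg (U * V) / K}) : q - p - y + (p - z) = q - (z + y).
  by rewrite addrAC addrA subrK opprD addrA addrAC.
have E c t : c *: tensor_pi t = tensor_pi (c *: t) by exact: tensor_scale_pi.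
split=> [v|u] c x y /=; rewrite /tens E -raddfD; apply/tensor_piP.
- have := tensor_nullD (tensor_null_addl (c *: x) y v)
                       (tensor_null_scalel c x v).
  by rewrite Z.
- have := tensor_nullD (tensor_null_addr u (c *: x) y)
                       (tensor_null_scaler c u x).
  by rewrite Z.
Qed.
HB.instance Definition _ := bilinear_isBilinear.Build K U V tensor _ _ tens
  tens_is_bilinear.
HB.instance Definition _ u :=
  GRing.isLinear.Build K V tensor _ (tens u) (tens_is_bilinear.2 u).

End TensorDef.

Notation "u ⊗ v" := (tens u v) (at level 40, left associativity) : ring_scope.

Section TensorLift.
Variables (K : fieldType) (U V W : lmodType K).

Lemma tensor_pi_sum (t : {freeg (U * V) / K}) :
  tensor_pi t = \sum_(z <- dom t) coeff z t *: (z.1 ⊗ z.2).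
Proof.
rewrite -{1}[t]freeg_sumE raddf_sum; apply: eq_bigr => -[u v] _.
rewrite [RHS]tensor_scale_pi; congr tensor_pi; apply/eqP/freeg_eqP => z.
by rewrite coeffZ !coeffU mul1r.
Qed.

Lemma tensor_sumP (t : tensor U V) :
  exists (n : nat) (u : 'I_n -> U) (v : 'I_n -> V), t = \sum_i u i ⊗ v i.
Proof.
rewrite -[t]tensor_pi_surj tensor_pi_sum; set s := dom _.
pose z i := nth (0, 0) s i.
exists (size s), (fun i => coeff (z i) (repr t) *: (z i).1), (fun i => (z i).2).
by rewrite (big_nth (0, 0)) big_mkord; apply: eq_bigr => i _; rewrite linearZl_LR.
Qed.

Lemma tensor_linear_ext (f g : {linear tensor U V -> W}) :
  (forall u v, f (u ⊗ v) = g (u ⊗ v)) -> f =1 g.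
Proof.
move=> fg t; have [n [u [v ->]]] := tensor_sumP t.
by rewrite !linear_sum; apply: eq_bigr.
Qed.

Variable f : {bilinear U -> V -> W}.

Definition tlift (t : tensor U V) : W := fglift (fun z => f z.1 z.2) (repr t).

Fact fglift_is_linear (h : U * V -> W) : linear (fglift (R := K) h).
Proof.
have D := lift_is_additive h.
pose hB := GRing.isZmodMorphism.Build _ _ _ D.
pose H : {additive _ -> _} := HB.pack (fglift (R := K) h) hB.
have Hsum t : H t = \sum_(z <- dom t) coeff z t *: h z.
  rewrite -{1}[t]freeg_sumE (raddf_sum H); apply: eq_bigr => z _ /=.
  by rewrite liftU.
move=> c x y; rewrite -[fglift h _]/(H _) (raddfD H); congr (_ + _).
rewrite -[c *: x]/(fgscale c x) /fgscale -[fglift h x]/(H x) (raddf_sum H).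
rewrite Hsum scaler_sumr; apply: eq_bigr => z _ /=.
by rewrite liftU scalerA.
Qed.

Fact tlift_pi t : tlift (tensor_pi t) = fglift (fun z => f z.1 z.2) t.
Proof.
set h := fun z => _.
have [H HE] : exists H : {linear {freeg (U * V) / K} -> W}, H =1 fglift h.
  pose hB := GRing.isLinear.Build _ _ _ _ _ (fglift_is_linear h).
  pose H : {linear {freeg (U * V) / K} -> W} := HB.pack (fglift (R := K) h) hB.
  by exists H.
rewrite -HE /tlift -/h -HE.
have /tensor_piP : tensor_pi (repr (tensor_pi t)) = tensor_pi t.
  exact: tensor_pi_surj.
suff E s : tensor_null s -> H s = 0.
  by move/E; rewrite raddfB => /eqP; rewrite subr_eq0 => /eqP.
have HU u v : H << (u, v) >> = f u v by rewrite HE liftU scale1r.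
elim=> [|x y _ Hx _ Hy|c x _ Hx|u u' v|u v v'|c u v|c u v].
- exact: linear0.
- by rewrite (linearD H) Hx Hy addr0.
- by rewrite (linearZ_LR H) Hx scaler0.
- by rewrite !(linearB H) !HU linearDl -addrA -opprD subrr.
- by rewrite !(linearB H) !HU linearDr -addrA -opprD subrr.
- by rewrite (linearB H) (linearZ_LR H) !HU linearZl_LR subrr.
- by rewrite (linearB H) (linearZ_LR H) !HU linearZr_LR subrr.
Qed.

Fact tlift_is_linear : linear tlift.
Proof.
move=> c t s; rewrite -[t]tensor_pi_surj -[s]tensor_pi_surj.
rewrite [c *: _]tensor_scale_pi -raddfD !tlift_pi.
exact: fglift_is_linear.
Qed.
HB.instance Definition _ := GRing.isLinear.Build K _ _ _ tlift tlift_is_linear.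

Lemma tliftE u v : tlift (u ⊗ v) = f u v.
Proof. by rewrite tlift_pi liftU scale1r. Qed.

End TensorLift.

Section TensorMap.
Variables (K : fieldType) (U U' V V' : lmodType K).
Variables (f : {linear U -> U'}) (g : {linear V -> V'}).

Definition tmap_fun (u : U) (v : V) := f u ⊗ g v.

Fact tmap_fun_is_bilinear :
  bilinear_for (GRing.Scale.Law.clone _ _ *:%R _)
    (GRing.Scale.Law.clone _ _ *:%R _) tmap_fun.
Proof.
split=> [v|u] c x y; rewrite /tmap_fun /= linearP.
  exact: linearPl.
exact: linearPr.
Qed.
HB.instance Definition _ := bilinear_isBilinear.Build K U V _ _ _ tmap_fun
  tmap_fun_is_bilinear.

Definition tmap : tensor U V -> tensor U' V' := tlift tmap_fun.
HB.instance Definition _ := GRing.Linear.on tmap.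

Lemma tmapE u v : tmap (u ⊗ v) = f u ⊗ g v.
Proof. exact: tliftE. Qed.
End TensorMap.

Notation "f \ox g" := (tmap f g) (at level 40, left associativity) : ring_scope.

Section TensorFlip.
Variables (K : fieldType) (U V : lmodType K).

Definition tflip_fun (u : U) (v : V) := v ⊗ u.

Fact tflip_fun_is_bilinear :
  bilinear_for (GRing.Scale.Law.clone _ _ *:%R _)
    (GRing.Scale.Law.clone _ _ *:%R _) tflip_fun.
Proof. by split=> [v|u] c x y; [exact: linearPr | exact: linearPl]. Qed.
HB.instance Definition _ := bilinear_isBilinear.Build K U V _ _ _ tflip_fun
  tflip_fun_is_bilinear.

Definition tflip : tensor U V -> tensor V U := tlift tflip_fun.
HB.instance Definition _ := GRing.Linear.on tflip.

Lemma tflipE u v : tflip (u ⊗ v) = v ⊗ u.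
Proof. exact: tliftE. Qed.
End TensorFlip.

(* Triple tensors are bracketed to the right.                                  *)
Section TensorTriple.
Variables (K : fieldType) (U V W : lmodType K).

Definition tassoc_fun (t : tensor U V) (w : W) : tensor U (tensor V W) :=
  (idfun \ox applyr (@tens K V W) w) t.

Fact tassoc_fun_is_bilinear :
  bilinear_for (GRing.Scale.Law.clone _ _ *:%R _)
    (GRing.Scale.Law.clone _ _ *:%R _) tassoc_fun.
Proof.
split=> [w|t] c x y; first exact: linearP.
pose h z : {linear tensor U V -> tensor U (tensor V W)} :=
  idfun \ox applyr (@tens K V W) z.
suff E : h (c *: x + y) =1 (c \*: h x) \+ h y by exact: (E t).
by apply: tensor_linear_ext => u v; rewrite /= !tmapE /= !linearPr.
Qed.
HB.instance Definition _ := bilinear_isBilinear.Build K _ W _ _ _ tassoc_fun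
  tassoc_fun_is_bilinear.

Definition tassoc : tensor (tensor U V) W -> tensor U (tensor V W) :=
  tlift tassoc_fun.
HB.instance Definition _ := GRing.Linear.on tassoc.

Lemma tassocE u v w : tassoc (u ⊗ v ⊗ w) = u ⊗ (v ⊗ w).
Proof. by rewrite /tassoc tliftE /= /tassoc_fun tmapE. Qed.

Definition tswap12_fun (u : U) (t : tensor V W) : tensor V (tensor U W) :=
  (idfun \ox tens u) t.

Fact tswap12_fun_is_bilinear :
  bilinear_for (GRing.Scale.Law.clone _ _ *:%R _)
    (GRing.Scale.Law.clone _ _ *:%R _) tswap12_fun.
Proof.
split=> [t|u] c x y; last exact: linearP.
pose h z : {linear tensor V W -> tensor V (tensor U W)} :=
  idfun \ox tens z.
suff E : h (c *: x + y) =1 (c \*: h x) \+ h y by exact: (E t).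
by apply: tensor_linear_ext => v w; rewrite /= !tmapE /= linearPl linearPr.
Qed.
HB.instance Definition _ := bilinear_isBilinear.Build K U _ _ _ _ tswap12_fun
  tswap12_fun_is_bilinear.

Definition tswap12 : tensor U (tensor V W) -> tensor V (tensor U W) :=
  tlift tswap12_fun.
HB.instance Definition _ := GRing.Linear.on tswap12.

Lemma tswap12E u v w : tswap12 (u ⊗ (v ⊗ w)) = v ⊗ (u ⊗ w).
Proof. by rewrite /tswap12 tliftE /= /tswap12_fun tmapE. Qed.
End TensorTriple.

Section Structures.
Variables (K : fieldType) (A : lmodType K).
Implicit Types (br : {bilinear A -> A -> A}) (D : {linear A -> tensor A A}).
Implicit Types (N S : {linear A -> A}).

Definition mockLie_algebra br : Prop :=
  (forall x y, br x y = br y x) /\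
  (forall x y z, br x (br y z) + br y (br z x) + br z (br x y) = 0).

Definition Nijenhuis_mockLie_algebra br N : Prop :=
  mockLie_algebra br /\
  (forall x y, br (N x) (N y) + N (N (br x y)) = N (br (N x) y) + N (br x (N y))).

Definition adjoint_admissible br N S : Prop :=
  forall x y, S (br (N x) y) + br x (S (S y)) = br (N x) (S y) + S (br x (S y)).

Definition ad br (x y : A) : A := br x y.
HB.instance Definition _ br x := GRing.Linear.copy (ad br x) (br x).

(* The three summands of the second clause are x_(1) ⊗ x_(2)(1) ⊗ x_(2)(2),    *)
(* x_(1)(1) ⊗ x_(1)(2) ⊗ x_(2) and x_(2)(1) ⊗ x_(1) ⊗ x_(2)(2).                *)
Definition mockLie_coalgebra D : Prop :=
  (forall x, D x = tflip (D x)) /\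
  (forall x, (idfun \ox D) (D x) + tassoc ((D \ox idfun) (D x))
             + tswap12 ((idfun \ox D) (D x)) = 0).

Definition mockLie_bialgebra br D : Prop :=
  [/\ mockLie_algebra br, mockLie_coalgebra D
    & forall x y, D (br x y) =
        - (ad br x \ox idfun) (D y) - (idfun \ox ad br x) (D y)
        - (ad br y \ox idfun) (D x) - (idfun \ox ad br y) (D x)].

Definition Nijenhuis_mockLie_coalgebra D S : Prop :=
  mockLie_coalgebra D /\
  (forall x, (S \ox S) (D x) + D (S (S x)) =
             (S \ox idfun) (D (S x)) + (idfun \ox S) (D (S x))).

Definition Nijenhuis_mockLie_bialgebra br D N S : Prop :=
  [/\ mockLie_bialgebra br D,
      Nijenhuis_mockLie_algebra br N /\ adjoint_admissible br N S,
      Nijenhuis_mockLie_coalgebra D S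
    & forall x, (S \ox idfun) (D (N x)) + (idfun \ox (N \o N)) (D x) =
                (S \ox N) (D x) + (idfun \ox N) (D (N x))].

End Structures.

(* Here r = \sum_i a i ⊗ b i, and r12r13, r13r23, r12r23 are the brackets      *)
(* [r_12, r_13], [r_13, r_23], [r_12, r_23]; every tensor has this form, see   *)
(* tensor_sumP.                                                                *)
Section Coboundary.
Variables (K : fieldType) (A : lmodType K) (br : {bilinear A -> A -> A}).
Variables (n : nat) (a b : 'I_n -> A).

Definition coboundary (x : A) : tensor A A :=
  \sum_(i < n) (br x (a i) ⊗ b i - a i ⊗ br x (b i)).

Fact coboundary_is_linear : linear coboundary.
Proof.
move=> c x y; rewrite /coboundary scaler_sumr -big_split; apply: eq_bigr => i _ /=.
by rewrite !linearPl linearPr scalerBr opprD addrACA.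
Qed.
HB.instance Definition _ :=
  GRing.isLinear.Build K _ _ _ coboundary coboundary_is_linear.

Definition r12r13 : tensor A (tensor A A) :=
  \sum_(i < n) \sum_(j < n) br (a i) (a j) ⊗ (b i ⊗ b j).
Definition r13r23 : tensor A (tensor A A) :=
  \sum_(i < n) \sum_(j < n) a i ⊗ (a j ⊗ br (b i) (b j)).
Definition r12r23 : tensor A (tensor A A) :=
  \sum_(i < n) \sum_(j < n) a i ⊗ (br (b i) (a j) ⊗ b j).

End Coboundary.

(* Main.v *)
Require Import Defs.
From HB Require Import structures.
From mathcomp Require Import all_boot all_algebra.

Set Implicit Arguments.
Unset Strict Implicit.

Import GRing.Theory.
Local Open Scope ring_scope.

(** Write [cob x] for the operator [ad x ⊗ id - id ⊗ ad x], so that the coboundary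
    is [D x = cob x r].  Each axiom of a Nijenhuis mock-Lie bialgebra, for [D],
    turns out to be an identity between operators applied to [r]:

    - the compatibility of [D] with the bracket always holds, because the Jacobi
      identity says [ad [x,y] = - ad x ad y - ad y ad x] and the mixed terms
      [ad x ⊗ ad y] cancel in pairs ([cob_cocycle]);
    - since the flip anticommutes with [cob x] ([tflip_cob]), [D x] minus its flip
      is [cob x (r + tflip r)], so cocommutativity is the first equation;
    - the co-Jacobi sum of [D x] is the opposite of the left side of the second
      equation, up to a term that is linear in [cob x (r + tflip r)]
      ([coJacobi_coboundary]).  Given cocommutativity that term vanishes and the
      two conditions agree;
    - the defect of [S] being Nijenhuis for [D] equals the left side of the third
      equation: their difference is the adjoint-admissibility identity applied to
      each leg of [r] ([cob_Nijenhuis_coalgebra]);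
    - the defect of the condition linking [N] and [S] equals the left side of
      the fourth equation: their difference is adjoint-admissibility on the first
      leg and the Nijenhuis identity of [N] on the second
      ([cob_Nijenhuis_compatible]).

    All of these are linear in a tensor, or double sums over the indices of [r],
    hence they reduce to pure tensors.  There the structural axioms rewrite
    iterated brackets to a normal form, and what remains is a cancellation in an
    abelian group, which the tactic [zmod] decides by reflection. *)

(** * Deciding identities in abelian groups *)

(** Syntax of sums and differences of atoms; an atom is a position in a list of
    group elements. *)
Inductive zexpr : Type :=
  | ZVar of nat | ZZero | ZAdd of zexpr & zexpr | ZOpp of zexpr.

Fixpoint zeval (V : zmodType) (env : seq V) (e : zexpr) : V :=
  match e with
  | ZVar k => env`_k
  | ZZero => 0
  | ZAdd e1 e2 => zeval env e1 + zeval env e2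
  | ZOpp e1 => - zeval env e1
  end.

Fixpoint zcoef (e : zexpr) (i : nat) : int :=
  match e with
  | ZVar k => (i == k)%:Z
  | ZZero => 0
  | ZAdd e1 e2 => zcoef e1 i + zcoef e2 i
  | ZOpp e1 => - zcoef e1 i
  end.

(** This holds for every [env]: a variable beyond its end evaluates to the default
    value 0, and contributes nothing to the sum. *)
Lemma zevalE (V : zmodType) (env : seq V) (e : zexpr) :
  zeval env e = \sum_(i < size env) env`_i *~ zcoef e i.
Proof.
elim: e => [k||e1 IH1 e2 IH2|e IH] /=.
- case: (ltnP k (size env)) => hk; last first.
    rewrite nth_default // big1 // => i _.
    by rewrite (ltn_eqF (leq_trans (ltn_ord i) hk)) mulr0z.
  rewrite (bigD1 (Ordinal hk)) //= eqxx mulr1z big1 ?addr0 // => i ne_ik.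
  by rewrite (_ : (i == k :> nat) = false) ?mulr0z //; apply/negbTE.
- by rewrite big1 // => i _; rewrite mulr0z.
- by rewrite IH1 IH2 -big_split; apply: eq_bigr => i _; rewrite mulrzDr.
- by rewrite IH -sumrN; apply: eq_bigr => i _; rewrite mulrNz.
Qed.

Lemma zeval_eq (V : zmodType) (env : seq V) (e1 e2 : zexpr) :
  all (fun i => zcoef e1 i == zcoef e2 i) (iota 0 (size env)) ->
  zeval env e1 = zeval env e2.
Proof.
move/allP=> h; rewrite !zevalE; apply: eq_bigr => i _.
by rewrite (eqP (h i _)) // mem_iota ltn_ord.
Qed.

Ltac zmod_mem x l :=
  match l with
  | nil => constr:(false)
  | cons x _ => constr:(true)
  | cons _ ?l' => zmod_mem x l'
  end.
Ltac zmod_index x l :=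
  match l with
  | cons x _ => constr:(O)
  | cons _ ?l' => let k := zmod_index x l' in constr:(S k)
  end.
Ltac zmod_atoms l t :=
  match t with
  | (?a + ?b)%R => let l' := zmod_atoms l a in zmod_atoms l' b
  | (- ?a)%R => zmod_atoms l a
  | 0%R => l
  | _ => match zmod_mem t l with
         | true => l
         | false => constr:(cons t l)
         end
  end.
Ltac zmod_quote l t :=
  match t with
  | (?a + ?b)%R =>
      let p := zmod_quote l a in let q := zmod_quote l b in
      constr:(ZAdd p q)
  | (- ?a)%R => let p := zmod_quote l a in constr:(ZOpp p)
  | 0%R => constr:(ZZero)
  | _ => let k := zmod_index t l in constr:(ZVar k)
  end.
(** Closes an equation between sums and differences of the same atoms.  Atoms are
    compared syntactically, so bilinear operations have to be expanded before. *)
Ltac zmod :=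
  match goal with
  | |- @eq ?T ?x ?y =>
      let l := zmod_atoms (@nil T) x in
      let l := zmod_atoms l y in
      let p := zmod_quote l x in
      let q := zmod_quote l y in
      apply: (@zeval_eq _ l p q); vm_compute; reflexivity
  end.

(** * Additivity of the tensor operations *)

(** These instances of [linearD], [linearN] and [linear_sum] have a fixed head
    symbol: rewriting with the generic lemmas would try every linear structure on
    every subterm. *)
Section TensorAdditivity.
Variables (K : fieldType) (U U' V V' W : lmodType K).
Implicit Types (f : {linear U -> U'}) (g : {linear V -> V'}).

Lemma tmapD f g t s : (f \ox g) (t + s) = (f \ox g) t + (f \ox g) s.
Proof. exact: linearD. Qed.
Lemma tmapN f g t : (f \ox g) (- t) = - (f \ox g) t.
Proof. exact: linearN. Qed.
Lemma tensDl (u u' : U) (v : V) : (u + u') ⊗ v = u ⊗ v + u' ⊗ v.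
Proof. exact: linearDl. Qed.
Lemma tensDr (u : U) (v v' : V) : u ⊗ (v + v') = u ⊗ v + u ⊗ v'.
Proof. exact: linearDr. Qed.
Lemma tensNl (u : U) (v : V) : (- u) ⊗ v = - (u ⊗ v).
Proof. exact: linearNl. Qed.
Lemma tensNr (u : U) (v : V) : u ⊗ (- v) = - (u ⊗ v).
Proof. exact: linearNr. Qed.

Lemma tens_suml n (F : 'I_n -> U) (v : V) :
  (\sum_(i < n) F i) ⊗ v = \sum_(i < n) F i ⊗ v.
Proof. exact: (linear_sum (applyr (@tens K U V) v)). Qed.
Lemma tens_sumr n (F : 'I_n -> V) (u : U) :
  u ⊗ (\sum_(i < n) F i) = \sum_(i < n) u ⊗ F i.
Proof. exact: linear_sum. Qed.
Lemma tflipD (t s : tensor U V) : tflip (t + s) = tflip t + tflip s.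
Proof. exact: linearD. Qed.
Lemma tflipN (t : tensor U V) : tflip (- t) = - tflip t.
Proof. exact: linearN. Qed.
Lemma tassocD (t s : tensor (tensor U V) W) : tassoc (t + s) = tassoc t + tassoc s.
Proof. exact: linearD. Qed.
Lemma tassocN (t : tensor (tensor U V) W) : tassoc (- t) = - tassoc t.
Proof. exact: linearN. Qed.
Lemma tswap12D (t s : tensor U (tensor V W)) :
  tswap12 (t + s) = tswap12 t + tswap12 s.
Proof. exact: linearD. Qed.
Lemma tswap12N (t : tensor U (tensor V W)) : tswap12 (- t) = - tswap12 t.
Proof. exact: linearN. Qed.

End TensorAdditivity.

Definition tens_add := (tensDl, tensDr, tensNl, tensNr).
Definition tassoc_add := (tassocD, tassocN, tassocE).
Definition tswap12_add := (tswap12D, tswap12N, tswap12E).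
Definition tmap_add := (tmapD, tmapN, tmapE).

(** * The coboundary operator and the compatibility with the bracket *)

Section Coboundary.
Variables (K : fieldType) (A : lmodType K) (br : {bilinear A -> A -> A}).
Implicit Types (x y : A) (t : tensor A A).

Notation cob x := ((ad br x \ox idfun) \- (idfun \ox ad br x)).

Lemma coboundaryE (n : nat) (a b : 'I_n -> A) x :
  coboundary br a b x = cob x (\sum_(i < n) a i ⊗ b i).
Proof.
rewrite linear_sum /coboundary; apply: eq_bigr => i _.
by rewrite /= !tmapE.
Qed.

(** The flip exchanges the two terms of [cob x], which carry opposite signs. *)
Lemma tflip_cob x t : tflip (cob x t) = - cob x (tflip t).
Proof.
apply: (tensor_linear_ext (f := @tflip K A A \o cob x)
                          (g := \- (cob x \o @tflip K A A))) => u v /=.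
rewrite !(tflipD, tflipN, tflipE, tmapE) /=; zmod.
Qed.

Hypothesis br_mockLie : mockLie_algebra br.

Lemma brC x y : br x y = br y x.
Proof. exact: br_mockLie.1. Qed.

(** Jacobi and commutativity, read as [ad [x,y] = - ad x ad y - ad y ad x]. *)
Lemma br_br x y z : br (br x y) z = - br x (br y z) - br y (br x z).
Proof.
rewrite (brC (br x y)) (brC x z).
apply/eqP; rewrite -subr_eq0; apply/eqP; rewrite -(br_mockLie.2 x y z); zmod.
Qed.

(** By [br_br] the left side is [- (ad x ad y + ad y ad x) ⊗ id] plus
    [id ⊗ (ad x ad y + ad y ad x)].  On the right, [ad x ⊗ ad y] and [ad y ⊗ ad x] each occur
    twice with opposite signs. *)
Lemma cob_cocycle x y t :
  cob (br x y) t = - (ad br x \ox idfun) (cob y t) - (idfun \ox ad br x) (cob y t)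
     - (ad br y \ox idfun) (cob x t) - (idfun \ox ad br y) (cob x t).
Proof.
apply: (tensor_linear_ext (f := cob (br x y))
  (g := ((\- ((ad br x \ox idfun) \o cob y)) \- ((idfun \ox ad br x) \o cob y))
     \- ((ad br y \ox idfun) \o cob x) \- ((idfun \ox ad br y) \o cob x)))
  => u v /=.
rewrite !tmap_add /= /ad !br_br !tens_add.
zmod.
Qed.

(** Jacobi in the form used for the co-Jacobi identity: it moves [x] to the
    innermost bracket, where it stands in the iterated brackets produced by the
    coboundary. *)
Lemma br_brr x y z : br x (br y z) = - br (br x y) z - br (br x z) y.
Proof.
rewrite (brC (br x y)) (brC (br x z)) (brC x z).
apply/eqP; rewrite -subr_eq0; apply/eqP; rewrite -(br_mockLie.2 x y z); zmod.
Qed.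

(** * The co-Jacobi identity *)

Section CoJacobi.
Variables (n : nat) (a b : 'I_n -> A).
Let r : tensor A A := \sum_(i < n) a i ⊗ b i.
Let D : {linear A -> tensor A A} := coboundary br a b.

Lemma coboundary_coassocr x :
  (idfun \ox D) (D x) = \sum_(i < n) \sum_(j < n)
    (br x (a i) ⊗ (br (b i) (a j) ⊗ b j - a j ⊗ br (b i) (b j))
     - a i ⊗ (br (br x (b i)) (a j) ⊗ b j - a j ⊗ br (br x (b i)) (b j))).
Proof.
rewrite [D x]/(coboundary br a b x) /coboundary linear_sum; apply: eq_bigr => i _.
by rewrite /= !tmap_add /= /coboundary !tens_sumr -sumrB.
Qed.

(** The outer coproduct is indexed by [j] here, and in half of the terms of
    [coboundary_coassoc_swap]: with this choice the terms that cancel in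
    [coJacobi_coboundary] occur at the same pair of indices. *)
Lemma coboundary_coassocl x :
  tassoc ((D \ox idfun) (D x)) = \sum_(i < n) \sum_(j < n)
    (br (br x (a j)) (a i) ⊗ (b i ⊗ b j) - a i ⊗ (br (br x (a j)) (b i) ⊗ b j)
     - br (a j) (a i) ⊗ (b i ⊗ br x (b j)) + a i ⊗ (br (a j) (b i) ⊗ br x (b j))).
Proof.
rewrite [D x]/(coboundary br a b x) /coboundary linear_sum linear_sum exchange_big.
apply: eq_bigr => i _.
rewrite /= !tmap_add /= /coboundary !tens_suml -sumrB linear_sum.
apply: eq_bigr => j _.
rewrite /= !tens_add !tassoc_add; zmod.
Qed.

Lemma coboundary_coassoc_swap x :
  tswap12 ((idfun \ox D) (D x)) = \sum_(i < n) \sum_(j < n)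
    (br (b i) (a j) ⊗ (br x (a i) ⊗ b j) - br (br x (b i)) (a j) ⊗ (a i ⊗ b j)
     - a i ⊗ (br x (a j) ⊗ br (b j) (b i))
     + a i ⊗ (a j ⊗ br (br x (b j)) (b i))).
Proof.
(* [G] holds the terms whose first leg is [a j]; only these are reindexed. *)
pose F i j := br (b i) (a j) ⊗ (br x (a i) ⊗ b j)
  - br (br x (b i)) (a j) ⊗ (a i ⊗ b j).
pose G i j := a j ⊗ (a i ⊗ br (br x (b i)) (b j))
  - a j ⊗ (br x (a i) ⊗ br (b i) (b j)).
transitivity (\sum_(i < n) \sum_(j < n) (F i j + G i j)).
  rewrite coboundary_coassocr linear_sum; apply: eq_bigr => i _.
  rewrite linear_sum; apply: eq_bigr => j _.
  rewrite /= !tens_add !tswap12_add /F /G; zmod.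
transitivity (\sum_(i < n) \sum_(j < n) F i j + \sum_(i < n) \sum_(j < n) G j i).
  rewrite [X in _ + X]exchange_big -big_split; apply: eq_bigr => i _ /=.
  by rewrite big_split.
rewrite -big_split; apply: eq_bigr => i _ /=.
rewrite -big_split; apply: eq_bigr => j _ /=.
by rewrite /F /G; zmod.
Qed.

Lemma ad3_cYBE x :
  ((ad br x \ox (idfun \ox idfun)) \+ (idfun \ox (ad br x \ox idfun))
     \+ (idfun \ox (idfun \ox ad br x)))
    (r12r13 br a b + r13r23 br a b - r12r23 br a b)
  = \sum_(i < n) \sum_(j < n)
    (br x (br (a i) (a j)) ⊗ (b i ⊗ b j) + br (a i) (a j) ⊗ (br x (b i) ⊗ b j)
     + br (a i) (a j) ⊗ (b i ⊗ br x (b j))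
     + (br x (a i) ⊗ (a j ⊗ br (b i) (b j)) + a i ⊗ (br x (a j) ⊗ br (b i) (b j))
        + a i ⊗ (a j ⊗ br x (br (b i) (b j))))
     - (br x (a i) ⊗ (br (b i) (a j) ⊗ b j) + a i ⊗ (br x (br (b i) (a j)) ⊗ b j)
        + a i ⊗ (br (b i) (a j) ⊗ br x (b j)))).
Proof.
have -> : r12r13 br a b + r13r23 br a b - r12r23 br a b =
   \sum_(i < n) \sum_(j < n) (br (a i) (a j) ⊗ (b i ⊗ b j)
      + a i ⊗ (a j ⊗ br (b i) (b j)) - a i ⊗ (br (b i) (a j) ⊗ b j)).
  rewrite -big_split -sumrB; apply: eq_bigr => i _ /=.
  by rewrite -big_split -sumrB.
rewrite linear_sum; apply: eq_bigr => i _.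
rewrite linear_sum; apply: eq_bigr => j _ /=.
rewrite !tmap_add /= !tmap_add /= /ad; zmod.
Qed.

Lemma ad_symmetric_defect x :
  \sum_(j < n) tassoc ((ad br (a j) \ox idfun) (cob x (r + tflip r)) ⊗ b j)
  = \sum_(i < n) \sum_(j < n) (br (a j) (br x (a i)) ⊗ (b i ⊗ b j)
     + br (a j) (br x (b i)) ⊗ (a i ⊗ b j) - br (a j) (a i) ⊗ (br x (b i) ⊗ b j)
     - br (a j) (b i) ⊗ (br x (a i) ⊗ b j)).
Proof.
have -> : r + tflip r = \sum_(i < n) (a i ⊗ b i + b i ⊗ a i).
  rewrite /r [tflip _]linear_sum -big_split; apply: eq_bigr => i _ /=.
  by rewrite tflipE.
rewrite exchange_big; apply: eq_bigr => j _.
rewrite [cob x _]linear_sum [(_ \ox _) _]linear_sum tens_suml [tassoc _]linear_sum.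
apply: eq_bigr => i _ /=.
rewrite !tmap_add /= /ad !tens_add !tassoc_add; zmod.
Qed.

(** In the co-Jacobi sum plus the action of [ad x] on
    [[r12, r13] + [r13, r23] - [r12, r23]], the terms whose first leg is [a i] or
    [br x (a i)], and those whose third leg is [br x (b j)], cancel, either at once
    or by the Jacobi identity.  The other ones have third leg [b j]; once Jacobi is
    applied to [br x (br (a i) (a j))], their first two legs form the opposite of
    [ad (a j) ⊗ id] applied to [cob x (r + tflip r)]. *)
Lemma coJacobi_coboundary x :
  (idfun \ox D) (D x) + tassoc ((D \ox idfun) (D x)) + tswap12 ((idfun \ox D) (D x))
  = - ((ad br x \ox (idfun \ox idfun)) \+ (idfun \ox (ad br x \ox idfun))
       \+ (idfun \ox (idfun \ox ad br x)))
        (r12r13 br a b + r13r23 br a b - r12r23 br a b)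
    - \sum_(j < n) tassoc ((ad br (a j) \ox idfun) (cob x (r + tflip r)) ⊗ b j).
Proof.
rewrite ad3_cYBE ad_symmetric_defect.
rewrite coboundary_coassoc_swap coboundary_coassocr coboundary_coassocl.
rewrite -!sumrN -!big_split; apply: eq_bigr => i _ /=.
rewrite -!sumrN -!big_split; apply: eq_bigr => j _ /=.
rewrite !(br_brr x) !tens_add.
rewrite (brC (a j) (br x (a i))) (brC (a j) (br x (b i))).
rewrite (brC (a j) (a i)) (brC (a j) (b i)) (brC (b j) (b i)).
zmod.
Qed.

End CoJacobi.

(** * The Nijenhuis conditions *)

Section Nijenhuis.
Variables (N S : {linear A -> A}).
Hypothesis br_N : Nijenhuis_mockLie_algebra br N.
Hypothesis br_S : adjoint_admissible br N S.

(** The two sides differ by the adjoint-admissibility identity with [x] as its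
    second argument, applied to the first leg of [t] and, with the opposite sign,
    to the second leg. *)
Lemma cob_Nijenhuis_coalgebra x t :
  (S \ox S) (cob x t) + cob (S (S x)) t
    - ((S \ox idfun) (cob (S x) t) + (idfun \ox S) (cob (S x) t)) =
  ((idfun \ox ad br (S x)) \- (idfun \ox (S \o ad br x)))
    (((S \ox idfun) \- (idfun \ox N)) t)
  + ((ad br (S x) \ox idfun) \- ((S \o ad br x) \ox idfun))
    (((N \ox idfun) \- (idfun \ox S)) t).
Proof.
apply: (tensor_linear_ext
  (f := (((S \ox S) \o cob x) \+ cob (S (S x)))
     \- (((S \ox idfun) \o cob (S x)) \+ ((idfun \ox S) \o cob (S x))))
  (g := (((idfun \ox ad br (S x)) \- (idfun \ox (S \o ad br x)))
           \o ((S \ox idfun) \- (idfun \ox N)))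
     \+ (((ad br (S x) \ox idfun) \- ((S \o ad br x) \ox idfun))
           \o ((N \ox idfun) \- (idfun \ox S))))) => u v /=.
have SSE w : br (S (S x)) w = br (S x) (N w) + S (br (S x) w) - S (br x (N w)).
  have /eqP := br_S w x; rewrite addrC -subr_eq -addrA => /eqP.
  by rewrite !(brC w) !(brC (N w)) => <-; zmod.
rewrite !tmap_add /= /ad !SSE !tens_add; zmod.
Qed.

(** The two sides differ by adjoint-admissibility on the first leg of [t], with
    [x] as its first argument, and by the Nijenhuis identity of [N] on the
    second. *)
Lemma cob_Nijenhuis_compatible x t :
  (S \ox idfun) (cob (N x) t) + (idfun \ox (N \o N)) (cob x t)
    - ((S \ox N) (cob x t) + (idfun \ox N) (cob (N x) t)) =
  (((S \o ad br x) \ox idfun) \+ (ad br (N x) \ox idfun)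
     \- (idfun \ox ad br (N x)) \+ (idfun \ox (N \o ad br x)))
    (((S \ox idfun) \- (idfun \ox N)) t)
  + ((ad br x \ox (N \o N)) \- ((ad br x \o (S \o S)) \ox idfun)) t.
Proof.
apply: (tensor_linear_ext
  (f := (((S \ox idfun) \o cob (N x)) \+ ((idfun \ox (N \o N)) \o cob x))
     \- (((S \ox N) \o cob x) \+ ((idfun \ox N) \o cob (N x))))
  (g := ((((S \o ad br x) \ox idfun) \+ (ad br (N x) \ox idfun)
           \- (idfun \ox ad br (N x)) \+ (idfun \ox (N \o ad br x)))
           \o ((S \ox idfun) \- (idfun \ox N)))
     \+ ((ad br x \ox (N \o N)) \- ((ad br x \o (S \o S)) \ox idfun))))
  => u v /=.
have SSE : br x (S (S u)) = br (N x) (S u) + S (br x (S u)) - S (br (N x) u).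
  by rewrite -br_S; zmod.
have NNE : br (N x) (N v) = N (br (N x) v) + N (br x (N v)) - N (N (br x v)).
  by rewrite -br_N.2; zmod.
rewrite !tmap_add /= /ad SSE NNE !tens_add.
(* The copy of [N (N _)] coming from [N \o N] differs in its implicit structure
   arguments; folding it lets the syntactic comparison of atoms succeed. *)
rewrite -[N (N (br x v))]/(N (N (br x v))); zmod.
Qed.

End Nijenhuis.

End Coboundary.

(** * The characterization of coboundary Nijenhuis bialgebras *)

Theorem theorem4p19 (K : fieldType) (K_char0 : [pchar K] =i pred0)
  (A : lmodType K) (br : {bilinear A -> A -> A}) (N S : {linear A -> A})
  (hN : Nijenhuis_mockLie_algebra br N) (hS : adjoint_admissible br N S)
  (n : nat) (a b : 'I_n -> A) (r : tensor A A)
  (hr : r = \sum_(i < n) a i ⊗ b i) :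
  Nijenhuis_mockLie_bialgebra br (coboundary br a b) N S <->
  [/\ forall x : A,
        ((ad br x \ox idfun) \- (idfun \ox ad br x)) (r + tflip r) = 0,
      forall x : A,
        ((ad br x \ox (idfun \ox idfun)) \+ (idfun \ox (ad br x \ox idfun))
         \+ (idfun \ox (idfun \ox ad br x)))
          (r12r13 br a b + r13r23 br a b - r12r23 br a b) = 0,
      forall x : A,
        ((idfun \ox ad br (S x)) \- (idfun \ox (S \o ad br x)))
          (((S \ox idfun) \- (idfun \ox N)) r)
        + ((ad br (S x) \ox idfun) \- ((S \o ad br x) \ox idfun))
          (((N \ox idfun) \- (idfun \ox S)) r) = 0
    & forall x : A,
        (((S \o ad br x) \ox idfun) \+ (ad br (N x) \ox idfun)
         \- (idfun \ox ad br (N x)) \+ (idfun \ox (N \o ad br x)))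
          (((S \ox idfun) \- (idfun \ox N)) r)
        + ((ad br x \ox (N \o N)) \- ((ad br x \o (S \o S)) \ox idfun)) r = 0].
Proof.
have hL := hN.1; have DE := coboundaryE br a b.
have symE : (forall x, coboundary br a b x = tflip (coboundary br a b x)) <->
    forall x, ((ad br x \ox idfun) \- (idfun \ox ad br x)) (r + tflip r) = 0.
  have E x : coboundary br a b x - tflip (coboundary br a b x) =
      ((ad br x \ox idfun) \- (idfun \ox ad br x)) (r + tflip r).
    by rewrite DE -hr tflip_cob opprK -linearD.
  by split=> h x; [rewrite -E -h subrr | apply: subr0_eq; rewrite E].
have jacE : (forall x, coboundary br a b x = tflip (coboundary br a b x)) ->
  forall x, (idfun \ox coboundary br a b) (coboundary br a b x)
    + tassoc ((coboundary br a b \ox idfun) (coboundary br a b x))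
    + tswap12 ((idfun \ox coboundary br a b) (coboundary br a b x)) =
    - ((ad br x \ox (idfun \ox idfun)) \+ (idfun \ox (ad br x \ox idfun))
         \+ (idfun \ox (idfun \ox ad br x)))
          (r12r13 br a b + r13r23 br a b - r12r23 br a b).
  move=> /symE h x; rewrite (coJacobi_coboundary hL a b x) -hr.
  rewrite [X in _ - X]big1 ?subr0 // => j _.
  by rewrite h [(_ \ox _) 0]linear0 linear0l [tassoc 0]linear0.
have coalgE x := cob_Nijenhuis_coalgebra hL hS x r.
have cmpE x := cob_Nijenhuis_compatible hN hS x r.
have coc : mockLie_bialgebra br (coboundary br a b) <->
    mockLie_coalgebra (coboundary br a b).
  split=> [[] //|h]; split=> // x y.
  by rewrite /= !DE (cob_cocycle hL).
split.
- case=> -[_ [sym jac] _] _ [_ nij] cmp; split.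
  + exact/symE.
  + by move=> x; apply/oppr_inj; rewrite -jacE // jac oppr0.
  + move=> x; rewrite -coalgE hr -!DE; apply/eqP; rewrite subr_eq0; apply/eqP/nij.
  + move=> x; rewrite -cmpE hr -!DE; apply/eqP; rewrite subr_eq0; apply/eqP/cmp.
- case=> /symE sym cybe nij cmp.
  have coalg : mockLie_coalgebra (coboundary br a b).
    by split=> // x; rewrite jacE // cybe oppr0.
  split=> //; first exact/coc.
    by split=> // x; apply: subr0_eq; rewrite /= !DE -hr coalgE.
  by move=> x; apply: subr0_eq; rewrite /= !DE -hr cmpE.
Qed.
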